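(* An identity between bracket symbols is valid if and only if it is valid for $h=0$. That is: let $B_I$ be the commutative polynomial algebra over $\mathbb C$ freely generated by commuting symbols $[ij]$, $i,j\in I$, and let $g_h:B_I\to H_I(h)$ be the algebra homomorphism with $g_h([ij])=(ij)=x_iy_j-y_ix_j-hy_iy_j$. Then for every $e\in B_I$ one has $g_h(e)=0$ if and only if $g_0(e)=0$.
   Context: For $h\in\mathbb C$ and a totally ordered index set $I$, $H_I=H_I(h)$ is the unital complex algebra with generators $x_i,y_i$ ($i\in I$) and relations $x_iy_i=y_ix_i+hy_i^2$ and, for $i<j$, $x_jy_i=y_ix_j+hy_iy_j$, $y_jx_i=x_iy_j-hy_iy_j$, $y_jy_i=y_iy_j$, $x_jx_i=x_ix_j-hx_iy_j+hy_ix_j+h^2y_iy_j$. For $h=0$ this is the commutative polynomial algebra in the $x_i,y_i$, and $(ij)=x_iy_j-y_ix_j$. The brackets $(ij)$ are central in $H_I(h)$. *)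

(* Defs.v *)
From HB Require Import structures.
From mathcomp Require Import all_boot all_order all_algebra.
From mathcomp Require Import finmap boolp.
From mathcomp Require Import generic_quotient ring_quotient monalg.

Set Implicit Arguments.
Unset Strict Implicit.
Unset Printing Implicit Defensive.

Import Order.TTheory GRing.Theory.
Local Open Scope ring_scope.
Local Open Scope quotient_scope.

Section Relations.
Variables (K : fieldType) (d : Order.disp_t) (I : orderType d) (h : K).

(* [Hrel x y u v] is the relation [u = v] between the elements [x i], [y i] of
   an algebra. *)
Inductive Hrel (A : lalgType K) (x y : I -> A) : A -> A -> Prop :=
| Hrel_xy i : Hrel x y (x i * y i) (y i * x i + h *: y i ^+ 2)
| Hrel_xjyi i j : (i < j)%O ->
    Hrel x y (x j * y i) (y i * x j + h *: (y i * y j))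
| Hrel_yjxi i j : (i < j)%O ->
    Hrel x y (y j * x i) (x i * y j - h *: (y i * y j))
| Hrel_yjyi i j : (i < j)%O -> Hrel x y (y j * y i) (y i * y j)
| Hrel_xjxi i j : (i < j)%O ->
    Hrel x y (x j * x i)
      (x i * x j - h *: (x i * y j) + h *: (y i * x j)
       + h ^+ 2 *: (y i * y j)).

(* The bracket $(ij)$. *)
Definition bracket (A : lalgType K) (x y : I -> A) (i j : I) : A :=
  x i * y j - y i * x j - h *: (y i * y j).

Section BracketTheory.
Variables (A : algType K) (x y : I -> A).
Hypothesis xy_rel : forall u v, Hrel x y u v -> u = v.
Local Notation br := (bracket x y).

Lemma yyC i j : y i * y j = y j * y i.
Proof.
case: (ltgtP i j) => [ij|ji|-> //].
- exact/esym/xy_rel/Hrel_yjyi.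
- exact/xy_rel/Hrel_yjyi.
Qed.

Lemma xyE i j : x i * y j = y j * x i + h *: (y i * y j).
Proof.
case: (ltgtP i j) => [ij|ji|<-].
- by rewrite (xy_rel (Hrel_yjxi _ _ ij)) subrK.
- by rewrite (xy_rel (Hrel_xjyi _ _ ji)) [y i * _]yyC.
- by rewrite (xy_rel (Hrel_xy _ _ i)) expr2.
Qed.

Lemma bracket_yx i j : br i j = y j * x i - y i * x j.
Proof. by rewrite /bracket xyE addrAC addrK. Qed.

Lemma bracketC i j : br j i = - br i j.
Proof. by rewrite !bracket_yx opprB. Qed.

Lemma xxE i j : x i * x j = x j * x i + h *: br i j.
Proof.
suff lt_case a b : (a < b)%O -> x b * x a = x a * x b + h *: br b a.
  case: (ltgtP i j) => [ij|ji|->].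
  - by rewrite (lt_case _ _ ij) bracketC scalerN addrNK.
  - exact: lt_case.
  - by rewrite bracket_yx subrr scaler0 addr0.
move=> ab; rewrite (xy_rel (Hrel_xjxi _ _ ab)) bracketC /bracket.
rewrite scalerN !scalerBr scalerA -expr2 !opprB -!addrA; congr (_ + _).
by rewrite addrC -addrA addrCA.
Qed.

Lemma bracket_commy i j k : GRing.comm (br i j) (y k).
Proof.
rewrite /GRing.comm bracket_yx mulrBl mulrBr -!mulrA (xyE i k) (xyE j k).
rewrite !mulrDr -!scalerAr !mulrA (yyC j i) (yyC j k) (yyC i k).
by rewrite opprD addrACA subrr addr0.
Qed.

Lemma bracket_commx i j k : GRing.comm (br i j) (x k).
Proof.
rewrite /GRing.comm.
have brE : y j * br i k - y i * br j k = y k * br i j.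
  rewrite !bracket_yx !mulrBr !mulrA (yyC j k) (yyC i k) (yyC j i) opprB.
  by rewrite addrA subrK.
have -> : br i j * x k
    = y j * (x k * x i) - y i * (x k * x j) + h *: (y k * br i j).
  rewrite {1}bracket_yx mulrBl -!mulrA (xxE i k) (xxE j k).
  rewrite (mulrDr (y j)) (mulrDr (y i)) -!scalerAr.
  by rewrite opprD addrACA -scalerBr brE.
rewrite [in RHS]bracket_yx [RHS]mulrBr !mulrA !(xyE k) !mulrDl opprD addrACA.
by rewrite -!scalerAl -scalerBr -!mulrA -mulrBr -bracket_yx.
Qed.

Lemma bracket_comm i j k l : GRing.comm (br i j) (br k l).
Proof.
rewrite [br k l]bracket_yx; apply: commrB; apply: commrM;
  by [apply: bracket_commx | apply: bracket_commy].
Qed.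

End BracketTheory.

Lemma Hrel_lift (A B : lalgType K) (f : {lrmorphism A -> B}) (x y : I -> A) u v :
  Hrel (f \o x) (f \o y) u v ->
  exists u' v', [/\ Hrel x y u' v', u = f u' & v = f v'].
Proof.
case=> [i|i j ij|i j ij|i j ij|i j ij].
- exists (x i * y i), (y i * x i + h *: y i ^+ 2).
  by split; [exact: Hrel_xy | rewrite rmorphM |
    rewrite rmorphD /= linearZ /= rmorphM rmorphXn].
- exists (x j * y i), (y i * x j + h *: (y i * y j)).
  by split; [exact: Hrel_xjyi | rewrite rmorphM |
    rewrite rmorphD /= linearZ /= !rmorphM].
- exists (y j * x i), (x i * y j - h *: (y i * y j)).
  by split; [exact: Hrel_yjxi | rewrite rmorphM |
    rewrite rmorphB /= [f (h *: _)]linearZ /= !rmorphM].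
- exists (y j * y i), (y i * y j).
  by split; [exact: Hrel_yjyi | rewrite rmorphM | rewrite rmorphM].
- exists (x j * x i), (x i * x j - h *: (x i * y j) + h *: (y i * x j)
    + h ^+ 2 *: (y i * y j)).
  by split; [exact: Hrel_xjxi | rewrite rmorphM |
    rewrite !rmorphD rmorphN /= ![f (_ *: _)]linearZ /= !rmorphM].
Qed.

End Relations.

Fact malg_scalerAr (K : fieldType) (M : monomType) (c : K)
  (u v : {malg K[M]}) : c *: (u * v) = u * (c *: v).
Proof.
apply/malgP => k; rewrite mcoeffZ mcoeffMl.
rewrite (mcoeffMlw _ (fsubset_refl _) (msuppZ_le _ _)) mulr_sumr.
apply: eq_bigr => k1 _; rewrite mulr_sumr; apply: eq_bigr => k2 _.
by rewrite mcoeffZ mulrnAr mulrCA.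
Qed.

Section Presentation.
Variables (K : fieldType) (d : Order.disp_t) (I : orderType d) (h : K).

(* The free algebra is the monoid algebra of the free monoid on two copies of
   [I]: the letter [inl i] is $x_i$ and the letter [inr i] is $y_i$. *)
Local Notation F := {malg K[{fmonom (I + I)%type}]}.

Definition fX (i : I) : F := << fmu (inl i) >>.
Definition fY (i : I) : F := << fmu (inr i) >>.

(* The two-sided ideal generated by the differences [u - v]. *)
Inductive Hideal_gen : F -> Prop :=
| Hgen_rel u v : Hrel h fX fY u v -> Hideal_gen (u - v)
| Hgen_0 : Hideal_gen 0
| Hgen_add u v : Hideal_gen u -> Hideal_gen v -> Hideal_gen (u + v)
| Hgen_mull a u : Hideal_gen u -> Hideal_gen (a * u)
| Hgen_mulr a u : Hideal_gen u -> Hideal_gen (u * a).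

Definition Hideal : {pred F} := fun u => `[< Hideal_gen u >].

Lemma Hideal_zmod_closed : zmod_closed Hideal.
Proof.
split=> [|u v /asboolP Iu /asboolP Iv]; apply/asboolP; first exact: Hgen_0.
by apply: Hgen_add => //; rewrite -mulN1r; apply: Hgen_mull.
Qed.
HB.instance Definition _ := GRing.isZmodClosed.Build F Hideal Hideal_zmod_closed.

Lemma HidealMl a u : u \in Hideal -> a * u \in Hideal.
Proof. by move=> /asboolP Iu; apply/asboolP; apply: Hgen_mull. Qed.

Lemma HidealMr a u : u \in Hideal -> u * a \in Hideal.
Proof. by move=> /asboolP Iu; apply/asboolP; apply: Hgen_mulr. Qed.

(* No relation has a constant term, so $H_I(h)$ is not the zero ring, as
   [algType] requires. *)
Lemma Hideal_const u : u \in Hideal -> u@_mone = 0.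
Proof.
have cX i : (fX i)@_mone = 0.
  by rewrite mcoeffU; case: eqP => // /(congr1 (@fdeg _)); rewrite fdegU fdeg1.
have cY i : (fY i)@_mone = 0.
  by rewrite mcoeffU; case: eqP => // /(congr1 (@fdeg _)); rewrite fdegU fdeg1.
have cM (a b : F) : (a * b)@_mone = a@_mone * b@_mone by rewrite rmorphM.
have cXM i a : (fX i * a)@_mone = 0 by rewrite cM cX mul0r.
have cYM i a : (fY i * a)@_mone = 0 by rewrite cM cY mul0r.
have cD (a b : F) : a@_mone = 0 -> b@_mone = 0 -> (a + b)@_mone = 0.
  by move=> a0 b0; rewrite mcoeffD a0 b0 addr0.
have cB (a b : F) : a@_mone = 0 -> b@_mone = 0 -> (a - b)@_mone = 0.
  by move=> a0 b0; rewrite mcoeffB a0 b0 subr0.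
have cZ c (a : F) : a@_mone = 0 -> (c *: a)@_mone = 0.
  by move=> a0; rewrite mcoeffZ a0 mulr0.
move=> /asboolP; elim=> {u} [u v uv||u v _ IHu _ IHv|a u _ IH|a u _ IH].
- case: uv => [i|i j _|i j _|i j _|i j _].
  + by rewrite expr2; apply: cB (cXM _ _) (cD _ _ (cYM _ _) (cZ _ _ (cYM _ _))).
  + exact: cB (cXM _ _) (cD _ _ (cYM _ _) (cZ _ _ (cYM _ _))).
  + exact: cB (cYM _ _) (cB _ _ (cXM _ _) (cZ _ _ (cYM _ _))).
  + exact: cB (cYM _ _) (cYM _ _).
  + apply: cB (cXM _ _) (cD _ _ (cD _ _ (cB _ _ (cXM _ _) (cZ _ _ (cXM _ _)))
      (cZ _ _ (cYM _ _))) (cZ _ _ (cYM _ _))).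
- exact: mcoeff0.
- by rewrite mcoeffD IHu IHv addr0.
- by rewrite cM IH mulr0.
- by rewrite cM IH mul0r.
Qed.

Lemma Hideal1 : 1 \notin Hideal.
Proof.
by apply/negP => /Hideal_const; rewrite rmorph1; move/eqP; rewrite oner_eq0.
Qed.

(* $H_I(h)$ *)
Definition Halg := Quotient.quot Hideal.
HB.instance Definition _ := GRing.Zmodule.on Halg.
HB.instance Definition _ := EqQuotient.on Halg.

Definition Hpi (u : F) : Halg := \pi u.

Lemma Hpi_eq (u v : F) : (Hpi u == Hpi v) = (u - v \in Hideal).
Proof. by rewrite -Quotient.idealrBE. Qed.

Lemma Hpi_surj (a : Halg) : exists u, a = Hpi u.
Proof. by exists (repr a); rewrite /Hpi reprK. Qed.

Lemma Hpi_repr (u : F) : u - repr (Hpi u) \in Hideal.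
Proof. by rewrite -Hpi_eq /Hpi reprK. Qed.

Lemma HpiD (u v : F) : Hpi (u + v) = Hpi u + Hpi v.
Proof. by rewrite /Hpi !piE. Qed.

Fact Hpi_zmod_morphism : zmod_morphism Hpi.
Proof. by move=> u v; rewrite /Hpi !piE. Qed.

(* Locked: unification between products in [{malg _}] can diverge. *)
Fact Halg_key : unit. Proof. by []. Qed.
Definition Hone : Halg := Hpi 1.
Definition Hmul : Halg -> Halg -> Halg :=
  locked_with Halg_key (fun a b => Hpi (repr a * repr b)).
Definition Hscale : K -> Halg -> Halg :=
  locked_with Halg_key (fun c a => Hpi (c *: repr a)).

Fact HpiM (u v : F) : Hpi (u * v) = Hmul (Hpi u) (Hpi v).
Proof.
rewrite [Hmul]unlock; apply/eqP; rewrite Hpi_eq; set u' := repr _; set v' := repr _.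
have uI : u - u' \in Hideal by exact: Hpi_repr.
have vI : v - v' \in Hideal by exact: Hpi_repr.
have -> : u * v - u' * v' = (u - u') * v + u' * (v - v').
  by rewrite mulrBl mulrBr addrA subrK.
by apply: rpredD; [apply: HidealMr | apply: HidealMl].
Qed.

Fact HpiZ (c : K) (u : F) : Hpi (c *: u) = Hscale c (Hpi u).
Proof.
rewrite [Hscale]unlock.
by apply/eqP; rewrite Hpi_eq -scalerBr -mul_malgC HidealMl ?Hpi_repr.
Qed.

Fact HmulA : associative Hmul.
Proof.
move=> a b c; have [u ->] := Hpi_surj a; have [v ->] := Hpi_surj b.
by have [w ->] := Hpi_surj c; rewrite -!HpiM mulrA.
Qed.

Fact Hmul1l : left_id Hone Hmul.
Proof. by move=> a; have [u ->] := Hpi_surj a; rewrite -HpiM mul1r. Qed.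

Fact Hmul1r : right_id Hone Hmul.
Proof. by move=> a; have [u ->] := Hpi_surj a; rewrite -HpiM mulr1. Qed.

Fact HmulDl : left_distributive Hmul +%R.
Proof.
move=> a b c; have [u ->] := Hpi_surj a; have [v ->] := Hpi_surj b.
by have [w ->] := Hpi_surj c; rewrite -HpiD -!HpiM mulrDl HpiD.
Qed.

Fact HmulDr : right_distributive Hmul +%R.
Proof.
move=> a b c; have [u ->] := Hpi_surj a; have [v ->] := Hpi_surj b.
by have [w ->] := Hpi_surj c; rewrite -HpiD -!HpiM mulrDr HpiD.
Qed.

Fact Hone_neq0 : Hone != 0.
Proof.
have -> : 0 = Hpi 0 by rewrite /Hpi piE.
by rewrite Hpi_eq subr0 Hideal1.
Qed.

Fact HscaleA a b u : Hscale a (Hscale b u) = Hscale (a * b) u.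
Proof. by have [v ->] := Hpi_surj u; rewrite -!HpiZ scalerA. Qed.

Fact Hscale1 : left_id 1 Hscale.
Proof. by move=> u; have [v ->] := Hpi_surj u; rewrite -!HpiZ scale1r. Qed.

Fact HscaleDr : right_distributive Hscale +%R.
Proof.
move=> c a b; have [u ->] := Hpi_surj a; have [v ->] := Hpi_surj b.
by rewrite -HpiD -!HpiZ scalerDr HpiD.
Qed.

Fact HscaleDl u : {morph Hscale^~ u : a b / a + b}.
Proof.
by move=> a b; have [v ->] := Hpi_surj u; rewrite -!HpiZ scalerDl HpiD.
Qed.

Fact HscaleAl (c : K) (a b : Halg) :
  Hscale c (Hmul a b) = Hmul (Hscale c a) b.
Proof.
have [u ->] := Hpi_surj a; have [v ->] := Hpi_surj b.
by rewrite -HpiM -!HpiZ scalerAl HpiM.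
Qed.

Fact HscaleAr (c : K) (a b : Halg) :
  Hscale c (Hmul a b) = Hmul a (Hscale c b).
Proof.
have [u ->] := Hpi_surj a; have [v ->] := Hpi_surj b.
by rewrite -HpiM -!HpiZ malg_scalerAr HpiM.
Qed.

HB.instance Definition _ := GRing.Zmodule_isNzRing.Build Halg
  HmulA Hmul1l Hmul1r HmulDl HmulDr Hone_neq0.
HB.instance Definition _ := GRing.Zmodule_isLmodule.Build K Halg
  HscaleA Hscale1 HscaleDr HscaleDl.
HB.instance Definition _ := GRing.Lmodule_isLalgebra.Build K Halg HscaleAl.
HB.instance Definition _ := GRing.Lalgebra_isAlgebra.Build K Halg HscaleAr.

HB.instance Definition _ :=
  GRing.isZmodMorphism.Build F Halg Hpi Hpi_zmod_morphism.
Fact Hpi_monoid_morphism : monoid_morphism Hpi.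
Proof. by split; [reflexivity | exact: HpiM]. Qed.
HB.instance Definition _ :=
  GRing.isMonoidMorphism.Build F Halg Hpi Hpi_monoid_morphism.
Fact Hpi_scalable : scalable Hpi.
Proof. exact: HpiZ. Qed.
HB.instance Definition _ :=
  GRing.isScalable.Build K F Halg *:%R Hpi Hpi_scalable.

Definition Hx (i : I) : Halg := Hpi (fX i).
Definition Hy (i : I) : Halg := Hpi (fY i).

Lemma Hpi_rel u v : Hrel h fX fY u v -> Hpi u = Hpi v.
Proof.
by move=> uv; apply/eqP; rewrite Hpi_eq; apply/asboolP; apply: Hgen_rel.
Qed.

Lemma Halg_rel u v : Hrel h Hx Hy u v -> u = v.
Proof. by case/(@Hrel_lift _ _ _ _ _ _ Hpi) => u' [v' [/Hpi_rel uv -> ->]]. Qed.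

Definition Hbr (i j : I) : Halg := bracket h Hx Hy i j.

Lemma Hbr_comm i j k l : GRing.comm (Hbr i j) (Hbr k l).
Proof. exact: bracket_comm Halg_rel i j k l. Qed.

End Presentation.

Section CommutingProducts.
Variables (A : nzRingType) (J : choiceType) (b : J -> A).
Hypothesis b_comm : forall p q, GRing.comm (b p) (b q).

Lemma perm_prod_comm (s t : seq J) (F : J -> A) :
  (forall p q, GRing.comm (F p) (F q)) -> perm_eq s t ->
  \prod_(p <- s) F p = \prod_(p <- t) F p.
Proof.
move=> FC; elim: s t => [t|p s IH t pst].
  by rewrite perm_sym => /perm_nilP ->.
have pt : p \in t by rewrite -(perm_mem pst) mem_head.
case/splitPr: pt pst => t1 t2; rewrite perm_sym perm_catC cat_cons perm_cons.
rewrite perm_catC perm_sym => /IH E.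
rewrite big_cons E !big_cat big_cons /= !mulrA; congr (_ * _).
by apply: commr_prod => q _; apply: FC.
Qed.

Lemma prod_cmonomEw (m : {cmonom J}) (E : {fset J}) :
  (finsupp m `<=` E)%fset ->
  \prod_(p <- finsupp m) b p ^+ m p = \prod_(p <- E) b p ^+ m p.
Proof.
move=> mE; have FC p q : GRing.comm (b p ^+ m p) (b q ^+ m q).
  exact/commrX/commr_sym/commrX/commr_sym.
rewrite -(perm_prod_comm FC (permEl (perm_filterC (mem (finsupp m)) E))).
rewrite big_cat /= [X in _ * X]big1_seq => [|p]; last first.
  by rewrite mem_filter /= -cmE_eq0 => /andP[/eqP ->].
rewrite mulr1; apply: (perm_prod_comm FC); apply: uniq_perm => // [|p].
  exact: filter_uniq.
by rewrite mem_filter andb_idr // => pm; exact: (fsubsetP mE).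
Qed.

Lemma prod_cmonom_mmorphism :
  mmorphism (fun m : {cmonom J} => \prod_(p <- finsupp m) b p ^+ m p).
Proof.
split=> [m n|]; last by rewrite mdom1 big_seq_fset0.
rewrite mdomD (prod_cmonomEw (fsubsetUl _ (finsupp n))).
rewrite (prod_cmonomEw (fsubsetUr (finsupp m) _)) -prodrM_comm => [|p q _ _].
- by apply: eq_bigr => p _; rewrite cmM exprD.
- exact/commrX/commr_sym/commrX/commr_sym.
Qed.

End CommutingProducts.

(* The polynomial algebra in the symbols $[ij]$. *)
Notation Balg K I := {malg K[{cmonom (I * I)%type}]}.

Section BracketMorphism.
Variables (K : fieldType) (d : Order.disp_t) (I : orderType d).

Definition bsym (i j : I) : Balg K I := << ucm (i, j) >>.

Variable h : K.
Local Notation H := (Halg I h).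

Definition bmonom (m : {cmonom (I * I)%type}) : H :=
  \prod_(p <- finsupp m) Hbr h p.1 p.2 ^+ m p.
HB.instance Definition _ := isMultiplicative.Build {cmonom (I * I)%type} H bmonom
  (prod_cmonom_mmorphism (fun p q => Hbr_comm h p.1 p.2 q.1 q.2)).

(* $g_h$; [bmap_bsym] is its defining property. *)
Definition bmap : Balg K I -> H := mmap (in_alg H) bmonom.

HB.instance Definition _ := GRing.Additive.on bmap.

Fact bmap_monoid_morphism : monoid_morphism bmap.
Proof.
have fC (e : Balg K I) m m' : GRing.comm (in_alg H e@_m) (bmonom m').
  by rewrite /GRing.comm /= mulr_algl mulr_algr.
have [M U] := commr_mmap_is_multiplicative fC.
by split.
Qed.
HB.instance Definition _ :=
  GRing.isMonoidMorphism.Build (Balg K I) H bmap bmap_monoid_morphism.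

Fact bmap_scalable : scalable bmap.
Proof. by move=> c e; rewrite /bmap mmapZ mulr_algl. Qed.
HB.instance Definition _ :=
  GRing.isScalable.Build K (Balg K I) H *:%R bmap bmap_scalable.

Lemma bmap_bsym i j : bmap (bsym i j) = Hbr h i j.
Proof.
rewrite /bmap mmapU /= scale1r mul1r /bmonom mdomU big_seq_fset1.
by rewrite cmUU expr1.
Qed.

End BracketMorphism.

(* Main.v *)
Require Import Defs.
From HB Require Import structures.
From mathcomp Require Import all_boot all_order all_algebra.
From mathcomp Require Import boolp functions reals complex finmap monalg.

Set Implicit Arguments.
Unset Strict Implicit.
Unset Printing Implicit Defensive.

Import Order.TTheory GRing.Theory.
Local Open Scope ring_scope.

(* For any h and k the algebra H(h) acts on H(k) so that each bracket (ij) of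
   H(h) acts as left multiplication by the bracket (ij) of H(k); applying
   g_h(e) to 1 gives g_k(e), so the kernels of g_h and g_k coincide.
   The action lets y_i act by y_i and x_i by x_i + (h - k) y_i E, where the
   linear endomorphism E of H(k) satisfies E y_i = y_i (E + 1) and
   E x_i = (x_i + 2 k y_i) E - x_i; for k = 0 it is the derivation
   "degree in y minus degree in x" of a polynomial ring. For general k it comes
   from the action of H(k) on pairs (u, E u). *)

(** * The algebra of linear endomorphisms *)

Section LinearEndomorphisms.
Variables (K : fieldType) (A : lalgType K).

Definition linfun_pred : {pred A -> A} := fun f => `[< linear f >].

Fact linfun_submod_closed : submod_closed linfun_pred.
Proof.
split=> [|c f g /asboolP fL /asboolP gL]; apply/asboolP => a u v.
  by rewrite scaler0 addr0.
rewrite !fctE/= fL gL !scalerDr !scalerA mulrC -!addrA; congr (_ + _).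
by rewrite addrCA.
Qed.
HB.instance Definition _ :=
  GRing.isSubmodClosed.Build K (A -> A) linfun_pred linfun_submod_closed.

(** A subtype of the function space inherits its vector space structure. Since [A] is an algebra,
    [1 != 0] in [A] separates the identity from zero, which the ring structure below requires. *)
Record lend := Lend { lend_fun :> A -> A; _ : lend_fun \in linfun_pred }.
HB.instance Definition _ := [isSub for lend_fun].
HB.instance Definition _ := [Choice of lend by <:].
HB.instance Definition _ := [SubChoice_isSubLmodule of lend by <:].

Lemma lendP (f g : lend) : f =1 g -> f = g.
Proof. by move=> /funext fg; apply: val_inj. Qed.

Definition lend_of (f : A -> A) (fL : linear f) : lend := Lend (asboolT fL).

Fact lend_linear (f : lend) : linear f.
Proof. by case: f => f /= /asboolP. Qed.
HB.instance Definition _ (f : lend) :=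
  GRing.isLinear.Build K A A *:%R f (lend_linear f).

Definition lend1 := lend_of (linearP idfun).
Definition lend_mul (f g : lend) := lend_of (linearP (f \o g)).

Fact lend_mulA : associative lend_mul.
Proof. by move=> f g k; apply: lendP. Qed.
Fact lend_mul1l : left_id lend1 lend_mul.
Proof. by move=> f; apply: lendP. Qed.
Fact lend_mul1r : right_id lend1 lend_mul.
Proof. by move=> f; apply: lendP. Qed.
Fact lend_mulDl : left_distributive lend_mul +%R.
Proof. by move=> f g k; apply: lendP. Qed.
Fact lend_mulDr : right_distributive lend_mul +%R.
Proof. by move=> f g k; apply: lendP => a; apply: (raddfD f). Qed.
Fact lend1_neq0 : lend1 != 0.
Proof.
by apply/eqP => /(congr1 (fun f : lend => f 1)) /eqP; rewrite oner_eq0.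
Qed.
HB.instance Definition _ := GRing.Zmodule_isNzRing.Build lend
  lend_mulA lend_mul1l lend_mul1r lend_mulDl lend_mulDr lend1_neq0.
Fact lend_scaleAl (c : K) (f g : lend) : c *: (f * g) = (c *: f) * g.
Proof. exact: lendP. Qed.
HB.instance Definition _ := GRing.Lmodule_isLalgebra.Build K lend lend_scaleAl.
Fact lend_scaleAr (c : K) (f g : lend) : c *: (f * g) = f * (c *: g).
Proof. by apply: lendP => a; apply/esym/(linearZZ f). Qed.
HB.instance Definition _ := GRing.Lalgebra_isAlgebra.Build K lend lend_scaleAr.
End LinearEndomorphisms.

(** * The left regular representation *)

Section LeftMultiplication.
Variables (K : fieldType) (A : algType K).

Definition lmul (a : A) : lend A := lend_of (linearP (a \*o idfun)).

Fact lmul_zmod_morphism : zmod_morphism lmul.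
Proof. by move=> a b; apply: lendP => u; apply: mulrBl. Qed.
HB.instance Definition _ :=
  GRing.isZmodMorphism.Build A (lend A) lmul lmul_zmod_morphism.
Fact lmul_monoid_morphism : monoid_morphism lmul.
Proof.
by split=> [|a b]; apply: lendP => u; [apply: mul1r | apply/esym/mulrA].
Qed.
HB.instance Definition _ :=
  GRing.isMonoidMorphism.Build A (lend A) lmul lmul_monoid_morphism.
Fact lmul_scalable : scalable lmul.
Proof. by move=> c a; apply: lendP => u; apply/esym/scalerAl. Qed.
HB.instance Definition _ :=
  GRing.isScalable.Build K A (lend A) *:%R lmul lmul_scalable.
End LeftMultiplication.

(** * Changing the parameter by the shift $x_i \mapsto x_i + y_i t$ *)

Section Deformation.
Variables (K : fieldType) (d : Order.disp_t) (I : orderType d).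

(* Converse of [yyC], [xyE] and [xxE]. *)
Lemma Hrel_eq (h : K) (A : algType K) (x y : I -> A) :
    (forall i j, y i * y j = y j * y i) ->
    (forall i j, x i * y j = y j * x i + h *: (y i * y j)) ->
    (forall i j, x i * x j - x j * x i = h *: (y j * x i - y i * x j)) ->
  forall u v, Hrel h x y u v -> u = v.
Proof.
move=> yy xy xx u v; case=> [i|i j ij|i j ij|i j ij|i j ij].
- by rewrite xy expr2.
- by rewrite xy (yy j).
- by rewrite xy addrK.
- exact: yy.
have -> : x j * x i = x i * x j - h *: (y j * x i - y i * x j).
  by rewrite -xx subKr.
have -> : y j * x i = x i * y j - h *: (y i * y j) by rewrite xy addrK.
rewrite !scalerBr scalerA -expr2 !opprB -!addrA; congr (_ + _).
by rewrite [LHS]addrA [LHS]addrC.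
Qed.

Lemma xx_commutator (h : K) (A : algType K) (x y : I -> A) :
    (forall u v, Hrel h x y u v -> u = v) ->
  forall i j, x i * x j - x j * x i = h *: (y j * x i - y i * x j).
Proof.
by move=> rel i j; rewrite (xxE rel i j) (bracket_yx rel) addrC addKr.
Qed.

Lemma shift_minor (A : pzRingType) (x y : I -> A) (t : A) :
    (forall i j, y i * y j = y j * y i) ->
  forall i j, y j * (x i + y i * t) - y i * (x j + y j * t)
    = y j * x i - y i * x j.
Proof.
by move=> yy i j; rewrite !mulrDr !mulrA (yy i j) opprD addrACA subrr addr0.
Qed.

(** Moving [t] past [y j] produces exactly the extra term $c\,y_iy_j$ of the mixed relation. In the
    product of two shifted $x$'s, the terms with [t] or [s] are symmetric in the indices, so the
    commutator only gains $c(y_jx_i - y_ix_j)$; this is why [s] can be arbitrary. *)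
Lemma Hrel_shift (h c : K) (A : algType K) (x y : I -> A) (t s : A) :
    (forall u v, Hrel h x y u v -> u = v) ->
    (forall i, t * y i = y i * t + c *: y i) ->
    (forall i, t * x i = x i * t + y i * s - c *: x i) ->
  forall u v, Hrel (h + c) (fun i => x i + y i * t) y u v -> u = v.
Proof.
move=> rel ty tx; have yy := yyC rel; have xy := xyE rel.
apply: Hrel_eq => [//|i j|i j].
- rewrite mulrDl mulrDr xy -mulrA ty mulrDr -scalerAr scalerDl !mulrA (yy i j).
  by rewrite [in RHS]addrACA.
(* Only the first and the last term fail to be symmetric in [a] and [b]. *)
have E a b : (x a + y a * t) * (x b + y b * t) = x a * x b
    + (y b * x a * t + y a * x b * t
       + y a * y b * (h *: t + s + (t * t + c *: t))) - c *: (y a * x b).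
  have -> : (x a + y a * t) * (x b + y b * t) = x a * x b + x a * y b * t
      + (y a * (t * x b) + y a * (t * y b * t)).
    by rewrite mulrDl !mulrDr !mulrA.
  rewrite xy ty tx !(mulrDl, mulrDr) mulrN -!scalerAr -!scalerAl !mulrA -!addrA.
  do 2!congr (_ + _); rewrite [LHS]addrCA; do 3!congr (_ + _).
  by rewrite -scalerAr mulrA [LHS]addrC addrA.
have Z (a a' b e e' : A) : a + b - e - (a' + b - e') = a - a' + (e' - e).
  by rewrite opprD opprK addrACA opprD (addrACA a) subrr addr0 [- e + _]addrC.
rewrite (shift_minor x t yy) !E (yy j i) [y i * x j * t + _]addrC Z.
by rewrite (xx_commutator rel) -scalerBr -scalerDl.
Qed.

(** Written as $y_jx_i - y_ix_j$, the bracket does not mention the parameter, and this form is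
    invariant under the shift. *)
Lemma bracket_shift (h c : K) (A : algType K) (x y : I -> A) (t s : A) :
    (forall u v, Hrel h x y u v -> u = v) ->
    (forall i, t * y i = y i * t + c *: y i) ->
    (forall i, t * x i = x i * t + y i * s - c *: x i) ->
  forall i j, bracket (h + c) (fun i => x i + y i * t) y i j = bracket h x y i j.
Proof.
move=> rel ty tx i j; rewrite (bracket_yx (Hrel_shift rel ty tx)).
by rewrite (bracket_yx rel) (shift_minor x t (yyC rel)).
Qed.

Lemma bracket_map (h : K) (A B : lalgType K) (f : {lrmorphism A -> B})
    (x y : I -> A) i j :
  f (bracket h x y i j) = bracket h (f \o x) (f \o y) i j.
Proof. by rewrite /bracket !rmorphB /= linearZ /= !rmorphM. Qed.
End Deformation.

(** * Evaluation of the free algebra *)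

Section FreeMonoid.
Variables (K : fieldType) (J : choiceType) (A : algType K) (z : J -> A).

Definition fmonom_eval (m : {fmonom J}) : A := \prod_(c <- m : seq J) z c.

Fact fmonom_eval_mmorphism : mmorphism fmonom_eval.
Proof.
by split=> [m n|]; rewrite /fmonom_eval ?fmM ?fm1 ?big_cat ?big_nil.
Qed.
HB.instance Definition _ :=
  isMultiplicative.Build {fmonom J} A fmonom_eval fmonom_eval_mmorphism.

Definition free_eval : {malg K[{fmonom J}]} -> A := mmap (in_alg A) fmonom_eval.
HB.instance Definition _ := GRing.Additive.on free_eval.
Fact free_eval_monoid_morphism : monoid_morphism free_eval.
Proof.
have fC (u : {malg K[{fmonom J}]}) m m' :
    GRing.comm (in_alg A u@_m) (fmonom_eval m').
  by rewrite /GRing.comm /= mulr_algl mulr_algr.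
by have [M U] := commr_mmap_is_multiplicative fC; split.
Qed.
HB.instance Definition _ := GRing.isMonoidMorphism.Build
  {malg K[{fmonom J}]} A free_eval free_eval_monoid_morphism.
Fact free_eval_scalable : scalable free_eval.
Proof. by move=> c u; rewrite /free_eval mmapZ mulr_algl. Qed.
HB.instance Definition _ := GRing.isScalable.Build K
  {malg K[{fmonom J}]} A *:%R free_eval free_eval_scalable.

Lemma free_evalU c : free_eval << fmu c >> = z c.
Proof.
by rewrite /free_eval mmapU /= scale1r mul1r /fmonom_eval fmU big_seq1.
Qed.
End FreeMonoid.

(** * Induction on $H_I(h)$ and its universal property *)

Section UniversalProperty.
Variables (K : fieldType) (d : Order.disp_t) (I : orderType d) (h : K).
Local Notation H := (Halg I h).

(** Words in the generators span the algebra, and each word arises from 1 by left multiplication by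
    its letters. *)
Lemma Halg_ind (P : H -> Prop) :
    P 1 -> (forall c u v, P u -> P v -> P (c *: u + v)) ->
    (forall i u, P u -> P (Hx h i * u)) -> (forall i u, P u -> P (Hy h i * u)) ->
  forall u, P u.
Proof.
move=> P1 PL Px Py u; have [{}u ->] := Hpi_surj u.
have P0 : P 0 by have := PL (-1) 1 1 P1 P1; rewrite scaleN1r addNr.
rewrite [u]monalgE raddf_sum; elim/big_rec: _ => // m v _ Pv.
rewrite -[<< _ *g m >>](_ : u@_m *: << m >> = _); last first.
  by apply/malgP => k; rewrite mcoeffZ !mcoeffU mulrnAr mulr1.
rewrite /= linearZ; apply: PL Pv => //.
rewrite -[m]fmK; elim: (m : seq _) => [|c s IH].
  by rewrite -fmoneE.
have -> : (<< FMonom (c :: s) >> : {malg K[{fmonom (I + I)%type}]})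
    = << fmu c >> * << FMonom s >>.
  rewrite malgM_def fgmulUU mulr1; congr << _ >>.
  by apply/eqP; rewrite fmP fmM fmU.
by rewrite rmorphM; case: c => i; [apply: Px | apply: Py].
Qed.

Lemma Hrel_map (A B : lalgType K) (f : {lrmorphism A -> B}) (x y : I -> A) u v :
  Hrel h x y u v -> Hrel h (f \o x) (f \o y) (f u) (f v).
Proof.
case=> [i|i j ij|i j ij|i j ij|i j ij].
- rewrite rmorphD /= linearZ /= !rmorphM.
  exact: (@Hrel_xy _ _ _ h B (f \o x) (f \o y)).
- rewrite rmorphD /= linearZ /= !rmorphM.
  exact: (@Hrel_xjyi _ _ _ h B (f \o x) (f \o y)).
- rewrite rmorphB /= [f (h *: _)]linearZ /= !rmorphM.
  exact: (@Hrel_yjxi _ _ _ h B (f \o x) (f \o y)).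
- rewrite !rmorphM.
  exact: (@Hrel_yjyi _ _ _ h B (f \o x) (f \o y)).
- rewrite !rmorphD rmorphN /= ![f (_ *: _)]linearZ /= !rmorphM.
  exact: (@Hrel_xjxi _ _ _ h B (f \o x) (f \o y)).
Qed.

Variables (A : algType K) (x y : I -> A).
Hypothesis xy_rel : forall u v, Hrel h x y u v -> u = v.

Local Notation letter :=
  (fun c : I + I => match c with inl i => x i | inr i => y i end).
Local Notation ev := (free_eval (K := K) letter).

(** Evaluation on the free algebra kills the generators of the ideal, hence the ideal, and so
    descends to the quotient. *)
Lemma Halg_lift : exists f : {lrmorphism H -> A},
  (forall i, f (Hx h i) = x i) /\ (forall i, f (Hy h i) = y i).
Proof.
have evX i : ev (fX K i) = x i by apply: free_evalU.
have evY i : ev (fY K i) = y i by apply: free_evalU.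
have ev0 u : u \in Hideal h -> ev u = 0.
  move=> /asboolP; elim=> {u} [u v uv||u v _ u0 _ v0|a u _ u0|a u _ u0].
  - rewrite raddfB; apply/eqP; rewrite subr_eq0; apply/eqP/xy_rel.
    have := Hrel_map ev uv.
    congr Hrel; apply/funext => i; [exact: evX | exact: evY].
  - exact: raddf0.
  - by rewrite raddfD /= u0 v0 addr0.
  - by rewrite rmorphM /= u0 mulr0.
  - by rewrite rmorphM /= u0 mul0r.
pose f (a : H) := ev (repr a).
(* The value does not depend on the chosen representative. *)
have fE u : f (Hpi h u) = ev u.
  by apply/esym/eqP; rewrite -subr_eq0 -raddfB; apply/eqP/ev0/Hpi_repr.
have fB : zmod_morphism f.
  move=> a b; have [u ->] := Hpi_surj a; have [v ->] := Hpi_surj b.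
  by rewrite -raddfB !fE raddfB.
have fM : monoid_morphism f.
  split=> [|a b]; first by rewrite -(rmorph1 (Hpi h)) fE rmorph1.
  have [u ->] := Hpi_surj a; have [v ->] := Hpi_surj b.
  by rewrite -rmorphM !fE rmorphM.
have fZ : scalable f.
  move=> c a; have [u ->] := Hpi_surj a.
  by rewrite -linearZ !fE linearZ.
pose mB := GRing.isZmodMorphism.Build H A f fB.
pose mM := GRing.isMonoidMorphism.Build H A f fM.
pose mZ := GRing.isScalable.Build K H A *:%R f fZ.
pose g : {lrmorphism H -> A} := HB.pack f mB mM mZ.
by exists g; split=> i; rewrite [LHS]fE.
Qed.
End UniversalProperty.

(** * The action on pairs that encodes [E] *)

Section Weight.
Variables (K : fieldType) (d : Order.disp_t) (I : orderType d) (h : K).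
Variables (A : algType K) (x y : I -> A).
Hypothesis xy_rel : forall u v, Hrel h x y u v -> u = v.

(* The action of [x i] and [y i] on pairs [(u, E u)]. *)
Definition weight_xfun i (u : A * A) : A * A :=
  (x i * u.1, (x i + y i * (h *+ 2)%:A) * u.2 - x i * u.1).
Definition weight_yfun i (u : A * A) : A * A :=
  (y i * u.1, y i * u.2 + y i * u.1).

Fact weight_xfun_linear i : linear (weight_xfun i).
Proof.
move=> c [u v] [u' v']; congr (_, _) => /=; rewrite !mulrDr -!scalerAr //.
by rewrite scalerBr opprD addrACA.
Qed.
Fact weight_yfun_linear i : linear (weight_yfun i).
Proof.
move=> c [u v] [u' v']; congr (_, _) => /=; rewrite !mulrDr -!scalerAr //.
by rewrite scalerDr addrACA.
Qed.

Definition weight_x i : lend (A * A)%type :=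
  lend_of (weight_xfun_linear i).
Definition weight_y i : lend (A * A)%type :=
  lend_of (weight_yfun_linear i).

(** The operators are block triangular. The diagonal blocks come from [x], [y] and from [S], [y],
    which both satisfy the relations; the off-diagonal block reduces to [Sy_sub] and [Sx_sym]. The
    constant $2h$ in [S] is the one that makes these two hold. *)
Lemma weight_rel u v : Hrel h weight_x weight_y u v -> u = v.
Proof.
have yy := yyC xy_rel; have xy := xyE xy_rel; have xx := xx_commutator xy_rel.
pose t : A := (h *+ 2)%:A; pose S i := x i + y i * t.
(* The scalar [t] is central, so this is a shift with [c = 0] and [s = 0], which keeps the
   parameter. *)
have S_rel u' v' : Hrel h S y u' v' -> u' = v'.
  have ty i : t * y i = y i * t + 0 *: y i.
    by rewrite scale0r addr0 mulr_algl mulr_algr.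
  have tx i : t * x i = x i * t + y i * 0 - 0 *: x i.
    by rewrite scale0r subr0 mulr0 addr0 mulr_algl mulr_algr.
  by have := Hrel_shift xy_rel ty tx; rewrite addr0; apply.
have Sy := xyE S_rel; have SS := xx_commutator S_rel.
have Sy_sub i j : S i * y j - x i * y j = h *: (y i * y j) *+ 2.
  rewrite mulrDl addrAC subrr add0r /t -mulrA mulr_algl -scalerAr.
  by rewrite scalerMnl.
have Sx_sym i j : S i * x j + x i * x j = S j * x i + x j * x i.
  have yt a b : y a * t * x b = (h *: (y a * x b)) *+ 2.
    by rewrite /t -mulrA mulr_algl -scalerAr scalerMnl.
  have dbl (a b : A) : a + b *+ 2 + a = (a + b) *+ 2.
    by rewrite mulrnDl addrAC -mulr2n.
  rewrite !mulrDl !yt !dbl -[x i * x j](subrK (x j * x i)) xx scalerBr.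
  by rewrite addrAC subrK addrC.
move: u v; apply: Hrel_eq => [i j|i j|i j]; apply: lendP => -[u v].
- by congr (_, _); rewrite /= ?mulrDr !mulrA (yy i j).
- congr (_, _) => /=; first by rewrite !mulrA xy mulrDl -scalerAl.
  rewrite -/t -/(S i) mulrBr subrK !mulrDr -addrA !mulrA -mulrBl Sy_sub Sy.
  rewrite mulrDl -!addrA; congr (_ + _).
  by rewrite !scalerDr !scalerAl mulr2n mulrDl.
- congr (_, _) => /=; first by rewrite !mulrA -!mulrBl xx scalerAl.
  (* Here [b] and [c] stand for the terms in the first coordinate [u]; their sum is symmetric in [i]
     and [j] by [Sx_sym]. *)
  have cancel_sum (a a' b b' c c' : A) :
      b + c = b' + c' -> a - b - c - (a' - b' - c') = a - a'.
    by move=> e; rewrite -(addrA a) -(addrA a') -!opprD e opprB addrA subrK.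
  rewrite -/t -/(S i) -/(S j) !mulrBr !subrK cancel_sum.
    by rewrite !mulrA -!mulrBl SS scalerAl.
  by rewrite !mulrA -mulrDl Sx_sym mulrDl.
Qed.
End Weight.

(** * Transfer of bracket identities between parameters *)

Section Transfer.
Variables (K : fieldType) (d : Order.disp_t) (I : orderType d).

Lemma weight_lend (h : K) : exists E : lend (Halg I h),
  (forall i, E * lmul (Hy h i) = lmul (Hy h i) * E + lmul (Hy h i)) /\
  (forall i, E * lmul (Hx h i) =
     lmul (Hx h i) * E + lmul (Hy h i) * ((h *+ 2) *: E) - lmul (Hx h i)).
Proof.
have [f [fX fY]] := Halg_lift (weight_rel (@Halg_rel K d I h)).
(* The first coordinate carries plain left multiplication, so [u] sends [(1, 0)] to [(u, e u)];
   starting from 0 in the second coordinate normalises [e 1 = 0]. *)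
have f1 u a : (f u a).1 = u * a.1.
  elim/Halg_ind: u => [|c u v IHu IHv|i u IH|i u IH].
  - by rewrite rmorph1 mul1r.
  - by rewrite linearP /= IHu IHv mulrDl scalerAl.
  - by rewrite rmorphM /= fX /= IH mulrA.
  - by rewrite rmorphM /= fY /= IH mulrA.
pose e (u : Halg I h) : Halg I h := (f u (1, 0)).2.
have eL : linear e by move=> c u v; rewrite /e linearP.
have exE i u : e (Hx h i * u)
    = Hx h i * e u + Hy h i * ((h *+ 2) *: e u) - Hx h i * u.
  rewrite /e rmorphM /= fX /= f1 mulr1 mulrDl.
  by rewrite -mulrA mulr_algl.
have eyE i u : e (Hy h i * u) = Hy h i * e u + Hy h i * u.
  by rewrite /e rmorphM /= fY /= f1 mulr1.
exists (lend_of eL).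
by split=> i; apply: lendP => u; [apply: eyE | apply: exE].
Qed.

(** Both sides are the same polynomial evaluated at the common images of the brackets. *)
Lemma rmorph_bmap (h k : K) (A : algType K) (f : {lrmorphism Halg I h -> A})
    (g : {lrmorphism Halg I k -> A}) :
  (forall i j, f (Hbr h i j) = g (Hbr k i j)) ->
  forall e, f (bmap h e) = g (bmap k e).
Proof.
move=> fg e; rewrite /bmap !mmapE !raddf_sum; apply: eq_bigr => m _ /=.
rewrite !mulr_algl !linearZ /=; congr (_ *: _).
rewrite /bmonom !rmorph_prod; apply: eq_bigr => p _.
by rewrite !rmorphXn /= fg.
Qed.

Lemma bmap_transfer (h k : K) (e : Balg K I) : bmap h e = 0 -> bmap k e = 0.
Proof.
move=> e0; have [E [Ey Ex]] := weight_lend k.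
have rel (u v : lend (Halg I k)) :
    Hrel k (@lmul _ _ \o Hx k) (@lmul _ _ \o Hy k) u v -> u = v.
  case/(@Hrel_lift _ _ _ _ _ _ (@lmul _ _)) => u' [v' [/Halg_rel uv -> ->]].
  by rewrite uv.
(* The shift is applied to left multiplications on $H_I(k)$, with $c = h - k$, $t = cE$ and $s =
   2kcE$. *)
have ty i : (h - k) *: E * lmul (Hy k i) =
    lmul (Hy k i) * ((h - k) *: E) + (h - k) *: lmul (Hy k i).
  by rewrite -scalerAl Ey scalerDr scalerAr.
have tx i : (h - k) *: E * lmul (Hx k i) = lmul (Hx k i) * ((h - k) *: E)
    + lmul (Hy k i) * ((h - k) *: (k *+ 2 *: E)) - (h - k) *: lmul (Hx k i).
  by rewrite -scalerAl Ex scalerBr scalerDr !scalerAr.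
have khk : k + (h - k) = h by rewrite addrC subrK.
have := Hrel_shift rel ty tx; rewrite khk => /Halg_lift[f [fX fY]].
have fbr i j : f (Hbr h i j) = lmul (Hbr k i j).
  rewrite /Hbr !bracket_map -(bracket_shift rel ty tx) khk.
  by congr (bracket h _ _ i j); apply/funext.
(* Left multiplication by $g_k(e)$ equals [f] of $g_h(e) = 0$; evaluating it at 1 recovers
   $g_k(e)$. *)
have := rmorph_bmap fbr e; rewrite e0 rmorph0 => /esym L0.
by rewrite -[LHS]mulr1; apply: (congr1 (fun g : lend _ => g 1) L0).
Qed.
End Transfer.

Theorem corollary6 (R : realType) (d : Order.disp_t) (I : orderType d)
    (h : R[i]) (e : Balg R[i] I) :
  bmap h e = 0 <-> bmap 0 e = 0.
Proof. by split; apply: bmap_transfer. Qed.
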